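(* The category $\mathbb{CA}$ of clone algebras and the full subcategory $\mathbb{CM}^{\mathrm{fr}}$ of $\mathbb{CM}$ whose objects are the finitely ranked cm-monoids are equivalent, through the functors $(\_)^{\mathrm{cm}}$ and $(\_)^{\mathrm{ca}}$ (the former corestricted to $\mathbb{CM}^{\mathrm{fr}}$, the latter restricted to $\mathbb{CM}^{\mathrm{fr}}$). This equivalence restricts to an equivalence between the full subcategory $\mathbb{CA}^{\mathrm{fd}}$ of finite-dimensional clone algebras and the full subcategory $\mathbb{CM}^{\mathrm{fdr}}$ of finite-dimensional and finitely ranked cm-monoids.
   Context: $S_\omega$ is the group of permutations $\sigma$ of $\omega$ with $\{n:\sigma(n)\neq n\}$ finite; such $\sigma$ is a permutation of $k=\{0,\dots,k-1\}$ if $\{n:\sigma(n)\ne n\}\subseteq k$. $\iota$ is the identity, $\tau^n_0$ is the transposition exchanging $0$ and $n$, and $\sigma_i=\sigma(i)$. A \emph{merge algebra} is $\mathbf A=(A,\star_n,\bar\sigma)_{n\in\omega,\sigma\in S_\omega}$ with $\star_n$ binary and $\bar\sigma$ unary such that: (B1) each $(A,\star_n)$ is an idempotent semigroup; (B2) $x\star_0y=y$; (B3) for $k\ge n$: $(x\star_k y)\star_n z=x\star_n z$ and $x\star_k(y\star_n z)=x\star_k z$; (B4) for $k<n$: $(x\star_k y)\star_n z=x\star_k(y\star_n z)$; (B5) $\bar\sigma(\bar\tau(x))=\overline{\tau\circ\sigma}(x)$ and $\bar\iota(x)=x$; (B6) if $n\le k$, $\sigma$ is a permutation of $k$, and $f_i=x$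 if $\sigma(i)<n$, $f_i=y$ otherwise ($0\le i<k$), then $\bar\sigma(x\star_n y)=((\dots(\bar\sigma(f_0)\star_1\bar\sigma(f_1))\star_2\dots)\star_{k-1}\bar\sigma(f_{k-1}))\star_k y$ (right-hand side read as $y$ if $k=0$); (B7) if $\sigma(i)=\tau(i)$ for all $m\le i<n$, then $(z\star_m\bar\sigma(x))\star_n y=(z\star_m\bar\tau(x))\star_n y$. A \emph{cm-monoid} is $\mathbf M=(M,\cdot,1,\star_n,\bar\sigma)_{n\in\omega,\sigma\in S_\omega}$ such that $(M,\cdot,1)$ is a monoid, $(M,\star_n,\bar\sigma)$ is a merge algebra, $(x\star_n y)\cdot z=(x\cdot z)\star_n(y\cdot z)$ for all $n$, and $\bar\sigma(x\cdot y)=\bar\sigma(x)\cdot y$ for all $\sigma\in S_\omega$. $\mathbb{CM}$ is the category of cm-monoids and homomorphisms. $\mathbf M$ is \emph{finitely ranked} if for every $x\in M$ there is $n$ with $x\star_n1=x$. An element $a\in M$ is \emph{finite-dimensional} if for every $n\in\omega$ there is $m\in\omega$ such that $(a\cdot(1\star_m b\star_{m+k}1))\star_n a=a$ for all $b\in M$ and $k\in\omega$; $\mathbf M$ is finite-dimensional if all its elements are. Put $M_{|1}=\{x\in M: x\star_1 1=x\}$ and $x[n]=\bar\tau^n_0(x)\star_1 1$. A \emph{clone algebra} is $\mathbf C=(C,q_n,\mathsf e_n)_{n\ge 0}$ with $\mathsf e_n\in C$ and $q_n$ of arity $n+1$ satisfying: (C1) $q_n(\mathsf e_i,x_0,\dots,x_{n-1})=x_i$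 ($0\le i\le n-1$); (C2) $q_n(\mathsf e_j,x_0,\dots,x_{n-1})=\mathsf e_j$ ($j\ge n$); (C3) $q_n(x,\mathsf e_0,\dots,\mathsf e_{n-1})=x$; (C4) $q_n(x,\mathbf y)=q_k(x,\mathbf y,\mathsf e_n,\dots,\mathsf e_{k-1})$ ($k>n$); (C5) $q_n(q_n(x,y_0,\dots,y_{n-1}),\mathbf z)=q_n(x,q_n(y_0,\mathbf z),\dots,q_n(y_{n-1},\mathbf z))$. $\mathbb{CA}$ is the category of clone algebras and homomorphisms. An element $a\in C$ is independent of $\mathsf e_n$ if $q_{n+1}(a,\mathsf e_0,\dots,\mathsf e_{n-1},\mathsf e_{n+1})=a$, and otherwise depends on $\mathsf e_n$; $a$ is finite-dimensional if it depends on only finitely many $\mathsf e_n$, and $\mathbf C$ is finite-dimensional if all its elements are. The functor $(\_)^{\mathrm{cm}}$: for a clone algebra $\mathbf C$ let $1=(\mathsf e_0,\mathsf e_1,\dots)\in C^\omega$ and $[1]_\equiv=\{s\in C^\omega: s_i\neq\mathsf e_i\text{ for only finitely many }i\}$. $\mathbf C^{\mathrm{cm}}$ has universe $[1]_\equiv$, unit $1$, $s\star_n u=(s_0,\dots,s_{n-1},u_n,u_{n+1},\dots)$, $\bar\sigma(s)=(s_{\sigma_i}:i\in\omega)$, and $b\cdot a=(q_k(b_i,a_0,\dots,a_{k-1}):i\in\omega)$ for any $k$ with $a_i=\mathsf e_i$ for all $i\ge k$ (independent of the choice of $k$). For $f:\mathbf C\to\mathbf B$, $f^{\mathrm{cm}}(a)=(f(a_i):i\in\omega)$.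 The functor $(\_)^{\mathrm{ca}}$: for a cm-monoid $\mathbf M$ and $b_0,\dots,b_{n-1}\in M_{|1}$, let $\widehat b_0=b_0$, $\widehat b_i=\widehat b_{i-1}\star_i\bar\tau^i_0(b_i)$ (and for $n=0$ read $\widehat b_{n-1}$ as $1$). $\mathbf M^{\mathrm{ca}}$ has universe $M_{|1}$, $\mathsf e_n=1[n]$ and $q_n(a,b_0,\dots,b_{n-1})=(a\cdot\widehat b_{n-1})\star_1 1$. For a morphism $g:\mathbf M\to\mathbf N$, $g^{\mathrm{ca}}$ is the restriction of $g$ to $M_{|1}\to N_{|1}$. *)

(* Defs.v *)
From mathcomp Require Import all_boot.
From mathcomp Require Import boolp classical_sets functions cardinality.

Set Implicit Arguments.
Unset Strict Implicit.
Unset Printing Implicit Defensive.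

Local Open Scope classical_set_scope.
#[local] Obligation Tactic := idtac.

Record category := Category {
  ob :> Type;
  hom : ob -> ob -> Type;
  idm : forall a, hom a a;
  compm : forall a b c, hom b c -> hom a b -> hom a c;
  compmA : forall a b c d (h : hom c d) (g : hom b c) (f : hom a b),
    compm h (compm g f) = compm (compm h g) f;
  comp1m : forall a b (f : hom a b), compm (idm b) f = f;
  compm1 : forall a b (f : hom a b), compm f (idm a) = f }.

Arguments idm {c} a : rename.

Record functor (C D : category) := Functor {
  fob :> C -> D;
  fhom : forall a b, hom a b -> hom (fob a) (fob b);
  fhom1 : forall a, fhom (idm a) = idm (fob a);
  fhomM : forall a b c (g : hom b c) (f : hom a b),
    fhom (compm g f) = compm (fhom g) (fhom f) }.

Definition id_functor (C : category) : functor C C :=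
  @Functor C C (fun a => a) (fun _ _ f => f)
    (fun _ => erefl) (fun _ _ _ _ _ => erefl).

Program Definition comp_functor (C D E : category)
    (G : functor D E) (F : functor C D) : functor C E :=
  @Functor C E (fun a => G (F a)) (fun _ _ f => fhom G (fhom F f)) _ _.
Next Obligation. by move=> C D E G F a /=; rewrite !fhom1. Qed.
Next Obligation. by move=> C D E G F a b c g f /=; rewrite !fhomM. Qed.

Record nat_iso (C D : category) (F G : functor C D) := NatIso {
  niso :> forall a, hom (F a) (G a);
  niso_inv : forall a, hom (G a) (F a);
  nisoK : forall a, compm (niso_inv a) (niso a) = idm (F a);
  niso_invK : forall a, compm (niso a) (niso_inv a) = idm (G a);
  niso_nat : forall a b (f : hom a b),
    compm (fhom G f) (niso a) = compm (niso b) (fhom F f) }.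

(* The triangle identities are not required: any unit and counit will do. *)
Record equivalence (C D : category) (F : functor C D) (G : functor D C) :=
  Equivalence {
    eq_unit : nat_iso (id_functor C) (comp_functor G F);
    eq_counit : nat_iso (comp_functor F G) (id_functor D) }.

Definition full_sub (C : category) (P : C -> Prop) : category :=
  @Category {a : C | P a} (fun a b => hom (sval a) (sval b))
    (fun a => idm (sval a)) (fun _ _ _ g f => compm g f)
    (fun _ _ _ _ h g f => compmA h g f)
    (fun _ _ f => comp1m f) (fun _ _ f => compm1 f).

Definition full_incl (C : category) (P : C -> Prop) : functor (full_sub P) C :=
  @Functor (full_sub P) C (fun a => sval a) (fun _ _ f => f)
    (fun _ => erefl) (fun _ _ _ _ _ => erefl).

Definition corestrict (C D : category) (F : functor C D) (Q : D -> Prop)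
    (FQ : forall a, Q (F a)) : functor C (full_sub Q) :=
  @Functor C (full_sub Q) (fun a => exist _ (F a) (FQ a))
    (fun _ _ f => fhom F f) (fun a => fhom1 F a)
    (fun _ _ _ g f => fhomM F g f).

Definition birestrict (C D : category) (F : functor C D)
    (P : C -> Prop) (Q : D -> Prop) (FPQ : forall a, P a -> Q (F a)) :
    functor (full_sub P) (full_sub Q) :=
  @corestrict _ _ (comp_functor F (full_incl P)) Q
    (fun a => FPQ (sval a) (svalP a)).

Record Somega := SOmega {
  sperm :> nat -> nat;
  sperm_bij : bijective sperm;
  sperm_fin : finite_set [set n | sperm n <> n] }.

Lemma Somega_ext (s t : Somega) : s =1 t -> s = t.
Proof.
case: s t => [s sb sf] [t tb tf] /= /funext st; subst t.
by rewrite (Prop_irrelevance sb tb) (Prop_irrelevance sf tf).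
Qed.

Lemma nat_finite_bound (A : set nat) :
  finite_set A <-> exists k, forall i, A i -> i < k.
Proof.
split=> [/finite_seqP[s ->]|[k Ak]].
  by exists (\max_(i <- s) i.+1) => i /= si; exact: (leq_bigmax_seq (F := S)).
apply: (@sub_finite_set _ _ [set` iota 0 k]); last exact: finite_seq.
by move=> i /Ak ik; rewrite /= mem_iota.
Qed.

Definition perm_of (k : nat) (s : Somega) := forall n, s n <> n -> n < k.

Lemma Somega_perm_of (s : Somega) : exists k, perm_of k s.
Proof. exact/nat_finite_bound/sperm_fin. Qed.

Program Definition siota : Somega := @SOmega id _ _.
Next Obligation. by exists id. Qed.
Next Obligation. by apply/nat_finite_bound; exists 0. Qed.

Program Definition scomp (t s : Somega) : Somega := @SOmega (t \o s) _ _.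
Next Obligation. by move=> t s; apply: bij_comp; exact: sperm_bij. Qed.
Next Obligation.
move=> t s; apply/nat_finite_bound.
have [k sk] := Somega_perm_of s; have [l tl] := Somega_perm_of t.
exists (maxn k l) => i /= tsi; rewrite leq_max.
case: (pselect (s i = i)) => [si|/sk -> //].
by rewrite tl ?orbT // => ti; apply: tsi; rewrite /= si.
Qed.

Definition tau_fun (n i : nat) : nat := if i == 0 then n else if i == n then 0 else i.

Lemma tau_funK n : involutive (tau_fun n).
Proof.
move=> i; rewrite /tau_fun; have [->|i0] := eqVneq i 0.
  by rewrite eqxx; case: eqVneq.
by have [->|ni] := eqVneq i n; rewrite ?eqxx // (negPf i0) (negPf ni).
Qed.

Program Definition stau (n : nat) : Somega := @SOmega (tau_fun n) _ _.
Next Obligation. move=> n; exact: inv_bij (@tau_funK n). Qed.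
Next Obligation.
move=> n; apply/nat_finite_bound; exists n.+1 => i; rewrite /tau_fun /=.
by case: eqVneq => [->//|i0]; case: eqVneq => [->|].
Qed.

Lemma stau0 n : stau n n = 0.
Proof. by rewrite /stau /tau_fun /= eqxx; case: eqVneq. Qed.

Lemma stau_gt n i : n < i -> stau n i = i.
Proof. by move=> ni; rewrite /stau /tau_fun /= !gtn_eqF // (leq_ltn_trans _ ni). Qed.

(* [nest star f j] is (...((f 0) star_1 (f 1)) star_2 ...) star_j (f j). *)
Fixpoint nest (A : Type) (star : nat -> A -> A -> A) (f : nat -> A) (j : nat) : A :=
  if j is j'.+1 then star j'.+1 (nest star f j') (f j'.+1) else f 0.

Record is_merge_algebra (A : Type) (star : nat -> A -> A -> A)
    (bar : Somega -> A -> A) : Prop := IsMergeAlgebra {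
  starA : forall n, associative (star n);
  starxx : forall n, idempotent_op (star n);
  star0 : forall x y, star 0 x y = y;
  star_geL : forall k n x y z, n <= k ->
    star n (star k x y) z = star n x z;
  star_geR : forall k n x y z, n <= k ->
    star k x (star n y z) = star k x z;
  star_lt : forall k n x y z, k < n ->
    star n (star k x y) z = star k x (star n y z);
  bar_comp : forall s t x, bar s (bar t x) = bar (scomp t s) x;
  bar_iota : forall x, bar siota x = x;
  bar_star : forall n k (s : Somega) x y, n <= k -> perm_of k s ->
    bar s (star n x y) =
      if k is k'.+1 then
        star k (nest star (fun i => bar s (if s i < n then x else y)) k') y
      else y;
  bar_local : forall m n (s t : Somega) x y z,
    (forall i, m <= i < n -> s i = t i) ->
    star n (star m z (bar s x)) y = star n (star m z (bar t x)) y }.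

Record cm_monoid := CmMonoid {
  cm_sort :> Type;
  cm_mul : cm_sort -> cm_sort -> cm_sort;
  cm_one : cm_sort;
  cm_star : nat -> cm_sort -> cm_sort -> cm_sort;
  cm_bar : Somega -> cm_sort -> cm_sort;
  cm_mulA : associative cm_mul;
  cm_mul1 : left_id cm_one cm_mul;
  cm_mulr1 : right_id cm_one cm_mul;
  cm_merge : is_merge_algebra cm_star cm_bar;
  cm_starM : forall n x y z,
    cm_mul (cm_star n x y) z = cm_star n (cm_mul x z) (cm_mul y z);
  cm_barM : forall s x y, cm_bar s (cm_mul x y) = cm_mul (cm_bar s x) y }.

Arguments cm_one {c}.

Record cm_hom (M N : cm_monoid) := CmHom {
  cm_fun :> M -> N;
  cm_fun_mul : forall x y, cm_fun (cm_mul x y) = cm_mul (cm_fun x) (cm_fun y);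
  cm_fun_one : cm_fun cm_one = cm_one;
  cm_fun_star : forall n x y,
    cm_fun (cm_star n x y) = cm_star n (cm_fun x) (cm_fun y);
  cm_fun_bar : forall s x, cm_fun (cm_bar s x) = cm_bar s (cm_fun x) }.

Lemma cm_hom_ext M N (f g : cm_hom M N) : f =1 g -> f = g.
Proof.
case: f g => [f a b c d] [g a' b' c' d'] /= /funext fg; subst g.
by congr CmHom; exact: Prop_irrelevance.
Qed.

Definition cm_id (M : cm_monoid) : cm_hom M M :=
  @CmHom M M id (fun _ _ => erefl) erefl (fun _ _ _ => erefl) (fun _ _ => erefl).

Program Definition cm_comp (M N P : cm_monoid)
  (g : cm_hom N P) (f : cm_hom M N) : cm_hom M P := @CmHom M P (g \o f) _ _ _ _.
Next Obligation. by move=> M N P g f x y /=; rewrite !cm_fun_mul. Qed.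
Next Obligation. by move=> M N P g f /=; rewrite !cm_fun_one. Qed.
Next Obligation. by move=> M N P g f n x y /=; rewrite !cm_fun_star. Qed.
Next Obligation. by move=> M N P g f s x /=; rewrite !cm_fun_bar. Qed.

Program Definition CM : category :=
  @Category cm_monoid cm_hom cm_id cm_comp _ _ _.
Next Obligation. by move=> *; exact: cm_hom_ext. Qed.
Next Obligation. by move=> *; exact: cm_hom_ext. Qed.
Next Obligation. by move=> *; exact: cm_hom_ext. Qed.

Definition cm_finitely_ranked (M : cm_monoid) : Prop :=
  forall x : M, exists n, cm_star n x cm_one = x.

Definition cm_fd_elt (M : cm_monoid) (a : M) : Prop :=
  forall n, exists m, forall (b : M) k,
    cm_star n (cm_mul a (cm_star (m + k) (cm_star m cm_one b) cm_one)) a = a.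

Definition cm_finite_dim (M : cm_monoid) : Prop := forall a : M, cm_fd_elt a.

Definition CMfr : category := @full_sub CM cm_finitely_ranked.

Definition CMfdr : category :=
  @full_sub CM (fun M => cm_finite_dim M /\ cm_finitely_ranked M).

(* The sequence y_0, ..., y_{n-1}, d_n, d_{n+1}, ... *)
Definition pad (A : Type) (d : nat -> A) n (y : 'I_n -> A) : nat -> A :=
  fun i => oapp y (d i) (insub i).

Record clone_algebra := CloneAlgebra {
  ca_sort :> Type;
  ca_e : nat -> ca_sort;
  ca_q : forall n, ca_sort -> ('I_n -> ca_sort) -> ca_sort;
  ca_qe : forall n (i : 'I_n) x, ca_q (ca_e i) x = x i;
  ca_qe_ge : forall n j (x : 'I_n -> ca_sort), n <= j -> ca_q (ca_e j) x = ca_e j;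
  ca_q_id : forall n x, ca_q x (fun i : 'I_n => ca_e i) = x;
  ca_q_pad : forall n k x (y : 'I_n -> ca_sort), n < k ->
    ca_q x y = ca_q x (fun i : 'I_k => pad ca_e y i);
  ca_qq : forall n x (y z : 'I_n -> ca_sort),
    ca_q (ca_q x y) z = ca_q x (fun i => ca_q (y i) z) }.

Arguments ca_e {c} n : rename.

Record ca_hom (C D : clone_algebra) := CaHom {
  ca_fun :> C -> D;
  ca_fun_e : forall n, ca_fun (ca_e n) = ca_e n;
  ca_fun_q : forall n x (y : 'I_n -> C),
    ca_fun (ca_q x y) = ca_q (ca_fun x) (fun i => ca_fun (y i)) }.

Lemma ca_hom_ext C D (f g : ca_hom C D) : f =1 g -> f = g.
Proof.
case: f g => [f a b] [g a' b'] /= /funext fg; subst g.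
by congr CaHom; exact: Prop_irrelevance.
Qed.

Definition ca_id (C : clone_algebra) : ca_hom C C :=
  @CaHom C C id (fun _ => erefl) (fun _ _ _ => erefl).

Program Definition ca_comp (C D E : clone_algebra)
  (g : ca_hom D E) (f : ca_hom C D) : ca_hom C E := @CaHom C E (g \o f) _ _.
Next Obligation. by move=> C D E g f n /=; rewrite !ca_fun_e. Qed.
Next Obligation. by move=> C D E g f n x y /=; rewrite !ca_fun_q. Qed.

Program Definition CA : category :=
  @Category clone_algebra ca_hom ca_id ca_comp _ _ _.
Next Obligation. by move=> *; exact: ca_hom_ext. Qed.
Next Obligation. by move=> *; exact: ca_hom_ext. Qed.
Next Obligation. by move=> *; exact: ca_hom_ext. Qed.

Definition ca_independent (C : clone_algebra) (a : C) (n : nat) : Prop :=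
  ca_q a (fun i : 'I_n.+1 => if i < n then ca_e i else ca_e n.+1) = a.

Definition ca_fd_elt (C : clone_algebra) (a : C) : Prop :=
  finite_set [set n | ~ ca_independent a n].

Definition ca_finite_dim (C : clone_algebra) : Prop := forall a : C, ca_fd_elt a.

Definition CAfd : category := @full_sub CA ca_finite_dim.

Section CmOfCa.
Variable C : clone_algebra.

Record thread := Thread {
  tseq :> nat -> C;
  tseq_fin : finite_set [set i | tseq i <> ca_e i] }.

Lemma thread_ext (s u : thread) : s =1 u -> s = u.
Proof.
case: s u => [s sf] [u uf] /= /funext su; subst u.
by congr Thread; exact: Prop_irrelevance.
Qed.

Lemma cofinite_thread (s : nat -> C) :
  (exists k, forall i, k <= i -> s i = ca_e i) ->
  finite_set [set i | s i <> ca_e i].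
Proof.
move=> [k sk]; apply/nat_finite_bound; exists k => i si.
by rewrite ltnNge; apply/negP => /sk.
Qed.

Lemma thread_cofinite (s : thread) : exists k, forall i, k <= i -> s i = ca_e i.
Proof.
have /nat_finite_bound[k sk] := tseq_fin s; exists k => i; rewrite leqNgt.
by move=> /negP ki; apply: contrapT => /sk.
Qed.

Definition trank (s : thread) : nat := sval (cid (thread_cofinite s)).

Lemma trankP (s : thread) i : trank s <= i -> s i = ca_e i.
Proof. by rewrite /trank; case: cid => k /= + ki; apply. Qed.

(* The choice of the bound is irrelevant, see [tsubstE]. *)
Definition tsubst (x : C) (s : thread) : C :=
  ca_q x (fun i : 'I_(trank s) => s i).

Lemma tsubstE (x : C) (s : thread) k : (forall i, k <= i -> s i = ca_e i) ->
  tsubst x s = ca_q x (fun i : 'I_k => s i).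
Proof.
have mono m n : m < n -> (forall i, m <= i -> s i = ca_e i) ->
    ca_q x (fun i : 'I_m => s i) = ca_q x (fun i : 'I_n => s i).
  move=> mn sm; rewrite (ca_q_pad _ _ mn); congr ca_q; apply: funext => i.
  by rewrite /pad; case: insubP => [j _ <- //|]; rewrite -leqNgt => /sm.
move=> sk; rewrite /tsubst; have [rk|kr|->//] := ltngtP (trank s) k.
  by apply: mono => // i; exact: trankP.
by apply/esym/mono.
Qed.

Lemma tsubst_e i (s : thread) : tsubst (ca_e i) s = s i.
Proof.
have [ir|ri] := ltnP i (trank s).
  exact: (ca_qe (Ordinal ir) (fun i : 'I_(trank s) => s i)).
by rewrite /tsubst ca_qe_ge // trankP.
Qed.

Lemma thread_mul_fin (b a : thread) :
  finite_set [set i | tsubst (b i) a <> ca_e i].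
Proof.
apply: cofinite_thread; exists (maxn (trank a) (trank b)) => i.
by rewrite geq_max => /andP[ai bi]; rewrite trankP // tsubst_e trankP.
Qed.

Definition thread_mul (b a : thread) : thread := Thread (thread_mul_fin b a).

Lemma thread_one_fin : finite_set [set i | ca_e i <> ca_e i :> C].
Proof. by apply: cofinite_thread; exists 0. Qed.

Definition thread_one : thread := Thread thread_one_fin.

Lemma thread_star_fin n (s u : thread) :
  finite_set [set i | (if i < n then s i else u i) <> ca_e i].
Proof.
apply: cofinite_thread; exists (maxn n (trank u)) => i.
by rewrite geq_max => /andP[ni ui]; rewrite ltnNge ni /= trankP.
Qed.

Definition thread_star n (s u : thread) : thread := Thread (thread_star_fin n s u).

Lemma thread_bar_fin (g : Somega) (s : thread) :
  finite_set [set i | s (g i) <> ca_e i].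
Proof.
have [k gk] := Somega_perm_of g.
apply: cofinite_thread; exists (maxn k (trank s)) => i.
rewrite geq_max => /andP[ki si]; suff -> : g i = i by rewrite trankP.
by apply: contrapT => /gk; rewrite ltnNge ki.
Qed.

Definition thread_bar (g : Somega) (s : thread) : thread :=
  Thread (thread_bar_fin g s).

Lemma tsubst1 x : tsubst x thread_one = x.
Proof. by rewrite /tsubst /= ca_q_id. Qed.

Lemma tsubstA x (b a : thread) :
  tsubst x (thread_mul b a) = tsubst (tsubst x b) a.
Proof.
pose k := maxn (trank a) (trank b).
have ak i : k <= i -> a i = ca_e i by rewrite geq_max => /andP[/trankP].
have bk i : k <= i -> b i = ca_e i by rewrite geq_max => /andP[_ /trankP].
rewrite (tsubstE (k := k) x); last first.
  by move=> i ki /=; rewrite bk // tsubst_e ak.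
rewrite (tsubstE _ ak) (tsubstE _ bk) ca_qq; congr ca_q; apply: funext => i /=.
exact: tsubstE.
Qed.

Lemma thread_nestE (f : nat -> thread) j i :
  nest thread_star f j i = (if i <= j then f i else f j) i.
Proof.
elim: j => [|j IH] /=; first by case: i.
by rewrite IH -(ltnS i j); case: (ltngtP i j.+1) => [||->].
Qed.

Lemma thread_merge : is_merge_algebra thread_star thread_bar.
Proof.
split.
- by move=> n x y z; apply: thread_ext => i /=; case: (i < n).
- by move=> n x; apply: thread_ext => i /=; case: (i < n).
- by move=> x y; apply: thread_ext => i.
- move=> k n x y z nk; apply: thread_ext => i /=.
  by case: ifP => // ni; rewrite (leq_trans ni nk).
- move=> k n x y z nk; apply: thread_ext => i /=.
  by case: (ltnP i k) => // ki; rewrite ltnNge (leq_trans nk ki).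
- move=> k n x y z kn; apply: thread_ext => i /=.
  by case: (ltnP i k) => // ik; rewrite (ltn_trans ik kn).
- by move=> s t x; apply: thread_ext => i.
- by move=> x; apply: thread_ext => i.
- move=> n k s x y nk sk; apply: thread_ext => i.
  have [ik|ki] := ltnP i k.
    case: k nk sk ik => // k nk sk ik.
    by rewrite /= ik thread_nestE -(ltnS i k) ik /=; case: ifP.
  have si : s i = i by apply: contrapT => /sk; rewrite ltnNge ki.
  rewrite /= si ltnNge (leq_trans nk ki) /=.
  by case: k ki {nk sk} => //= k ki; rewrite ltnNge ki.
- move=> m n s t x y z st; apply: thread_ext => i /=.
  by case: (ltnP i n) => // i_n; case: (ltnP i m) => // mi; rewrite st ?mi.
Qed.

Program Definition cm_of_ca : cm_monoid :=
  @CmMonoid thread thread_mul thread_one thread_star thread_bar _ _ _ thread_merge _ _.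
Next Obligation. by move=> x y z; apply: thread_ext => i /=; rewrite tsubstA. Qed.
Next Obligation. by move=> x; apply: thread_ext => i /=; rewrite tsubst_e. Qed.
Next Obligation. by move=> x; apply: thread_ext => i /=; rewrite tsubst1. Qed.
Next Obligation. by move=> n x y z; apply: thread_ext => i /=; case: ifP. Qed.
Next Obligation. by move=> s x y; apply: thread_ext. Qed.

Lemma cm_of_ca_finitely_ranked : cm_finitely_ranked cm_of_ca.
Proof.
move=> x; exists (trank x); apply: thread_ext => i /=.
by case: ltnP => // ri; rewrite trankP.
Qed.

End CmOfCa.

Section CmOfCaHom.
Variables (C D : clone_algebra) (f : ca_hom C D).

Lemma thread_map_fin (s : thread C) : finite_set [set i | f (s i) <> ca_e i].
Proof.
apply: cofinite_thread; exists (trank s) => i si.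
by rewrite trankP // ca_fun_e.
Qed.

Definition thread_map (s : thread C) : thread D := Thread (thread_map_fin s).

Program Definition cm_of_ca_hom : cm_hom (cm_of_ca C) (cm_of_ca D) :=
  @CmHom (cm_of_ca C) (cm_of_ca D) thread_map _ _ _ _.
Next Obligation.
move=> x y; apply: thread_ext => i /=.
rewrite (@tsubstE _ _ (thread_map y) (trank y)) ?ca_fun_q // => j yj /=.
by rewrite trankP // ca_fun_e.
Qed.
Next Obligation. by apply: thread_ext => i; exact: ca_fun_e. Qed.
Next Obligation. by move=> n x y; apply: thread_ext => i /=; case: ifP. Qed.
Next Obligation. by move=> s x; apply: thread_ext. Qed.

End CmOfCaHom.

Program Definition cm_functor : functor CA CM :=
  @Functor CA CM cm_of_ca cm_of_ca_hom _ _.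
Next Obligation. by move=> C; apply: cm_hom_ext => s; exact: thread_ext. Qed.
Next Obligation.
by move=> C D E g f; apply: cm_hom_ext => s; exact: thread_ext.
Qed.

Definition cm_fr_functor : functor CA CMfr :=
  @corestrict CA CM cm_functor cm_finitely_ranked cm_of_ca_finitely_ranked.

Section CaOfCm.
Variable M : cm_monoid.
Local Notation star := (@cm_star M).
Local Notation bar := (@cm_bar M).
Local Notation mul := (@cm_mul M).
Local Notation one := (@cm_one M).
Let mM := cm_merge M.

Definition M1 := {x : M | star 1 x one = x}.

Definition cm_coord (x : M) (n : nat) : M := star 1 (bar (stau n) x) one.

Fixpoint cm_hat (b : nat -> M) (i : nat) : M :=
  if i is i'.+1 then star i (cm_hat b i') (bar (stau i) (b i)) else b 0.

(* The element \hat b_{n-1}, read as the unit when n = 0. *)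
Definition cm_hat_pred n (b : 'I_n -> M) : M :=
  if n is n'.+1 then cm_hat (pad (fun _ => one) b) n' else one.

Lemma M1_ext (x y : M1) : sval x = sval y -> x = y.
Proof. by case: x y => [x px] [y py] /= xy; exact: eq_exist. Qed.

Lemma star1_M1 (x : M) : star 1 (star 1 x one) one = star 1 x one.
Proof. by rewrite (star_geL mM). Qed.

Definition to_M1 (x : M) : M1 := exist _ (star 1 x one) (star1_M1 x).

(* x and y have the same i-th coordinate when elements are viewed as sequences. *)
Definition coeq i (x y : M) :=
  forall z w, star i.+1 (star i z x) w = star i.+1 (star i z y) w.

Lemma coeq_refl i x : coeq i x x. Proof. by []. Qed.
Lemma coeq_sym i x y : coeq i x y -> coeq i y x.
Proof. by move=> xy z w; rewrite xy. Qed.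
Lemma coeq_trans i y x z : coeq i x y -> coeq i y z -> coeq i x z.
Proof. by move=> xy yz u w; rewrite xy. Qed.

Lemma coeq_starP n x y w : (forall i, i < n -> coeq i x y) ->
  star n x w = star n y w.
Proof.
elim: n w => [|n IH] w xy; first by rewrite !(star0 mM).
rewrite -{1}(starxx mM n x) xy // (star_lt mM) // IH; last first.
  by move=> i ni; apply: xy; exact: ltnW.
by rewrite -(star_lt mM) // (starxx mM).
Qed.

Lemma coeq_starL i n x y : i < n -> coeq i (star n x y) x.
Proof.
by move=> i_n z w; rewrite !(star_lt mM _ _ _ (ltnSn i)) (star_geL mM).
Qed.

Lemma coeq_starR i n x y : n <= i -> coeq i (star n x y) y.
Proof. by move=> ni z w; rewrite (star_geR mM). Qed.

Lemma coeq_nest f i j : i <= j -> coeq i (nest star f j) (f i).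
Proof.
elim: j => [|j IH] /=; first by rewrite leqn0 => /eqP ->.
rewrite leq_eqVlt => /predU1P[->|ij]; first exact: coeq_starR.
by apply: (coeq_trans (coeq_starL _ _ ij)); exact: IH.
Qed.

Lemma coeq_bar_star (s : Somega) n x y j :
  coeq j (bar s (star n x y)) (bar s (if s j < n then x else y)).
Proof.
have [k sk] := Somega_perm_of s; pose l := maxn n (maxn k j).
have nl : n <= l.+1 by rewrite leqW // leq_maxl.
have jl : j < l.+1 by rewrite ltnS !leq_max leqnn !orbT.
rewrite (bar_star mM _ _ nl) => [|i /sk ik]; last first.
  by rewrite ltnS !leq_max (ltnW ik) orbT.
apply: (coeq_trans (coeq_starL _ _ jl)).
exact: (coeq_nest (fun i => bar s (if s i < n then x else y))).
Qed.

Lemma coeq_bar (s : Somega) i j x y :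
  s j = i -> coeq i x y -> coeq j (bar s x) (bar s y).
Proof.
move=> sj xy.
have H z : coeq j (bar s (star i.+1 (star i x z) x)) (bar s z).
  apply: (coeq_trans (coeq_bar_star _ _ _ _ _)); rewrite sj ltnSn.
  by have := coeq_bar_star s i x z j; rewrite sj ltnn.
by apply: (coeq_trans (coeq_sym (H x))); rewrite xy.
Qed.

Lemma coeq_local (s t : Somega) j x : s j = t j -> coeq j (bar s x) (bar t x).
Proof.
move=> st z w; apply: (bar_local mM) => i.
by rewrite ltnS -eqn_leq => /eqP <-.
Qed.

Lemma coeq_mul i x y u : coeq i x y -> coeq i (mul x u) (mul y u).
Proof.
move=> xy z w.
have H v : star i.+1 (star i z (mul v u)) w =
    star i z (star i.+1 (mul (star i.+1 (star i one v) one) u) w).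
  rewrite !cm_starM (star_geL mM _ _ w (leqnn i.+1)).
  by rewrite !(star_lt mM _ _ _ (ltnSn i)) (star_geR mM _ _ _ (leqnn i)).
by rewrite !H xy.
Qed.

Lemma coeq_eq n x y : star n x one = x -> star n y one = y ->
  (forall i, i < n -> coeq i x y) -> x = y.
Proof. by move=> xn yn xy; rewrite -xn -yn; exact: coeq_starP. Qed.

Lemma bar_tauK n x : bar (stau n) (bar (stau n) x) = x.
Proof.
rewrite (bar_comp mM) (_ : scomp _ _ = siota) ?(bar_iota mM) //.
by apply: Somega_ext => i; exact: tau_funK.
Qed.

(* Since x star_0 y = y, the special case of [cm_hat] at index 0 can be absorbed. *)
Fixpoint hatn (b : nat -> M) (n : nat) : M :=
  if n is n'.+1 then star n' (hatn b n') (bar (stau n') (b n')) else one.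

Lemma cm_hat_predE n (b : 'I_n -> M) :
  cm_hat_pred b = hatn (pad (fun _ => one) b) n.
Proof.
suff hatE c k : cm_hat c k = hatn c k.+1 by case: n b => // n b; exact: hatE.
elim: k => [|k IH]; last by rewrite /= IH.
rewrite /= (star0 mM) (_ : stau 0 = siota) ?(bar_iota mM) //.
by apply: Somega_ext => i; rewrite /stau /tau_fun /=; case: eqVneq.
Qed.

Lemma coeq_hatn b n i : i < n -> coeq i (hatn b n) (bar (stau i) (b i)).
Proof.
elim: n => // n IH /=.
rewrite ltnS leq_eqVlt => /predU1P[->|i_n]; first exact: coeq_starR.
by apply: (coeq_trans (coeq_starL _ _ i_n)); exact: IH.
Qed.

Lemma bar_tau_rank n b : star 1 b one = b ->
  bar (stau n) b = star n.+1 (bar (stau n) b) one.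
Proof.
move=> <-; rewrite (@bar_star _ _ _ mM 1 n.+1) //; last first.
  move=> i; rewrite ltnS leqNgt => ti; apply/negP => /stau_gt.
  exact: ti.
by rewrite (star_geL mM).
Qed.

Lemma hatn_rank (b : nat -> M) n : (forall i, star 1 (b i) one = b i) ->
  star n (hatn b n) one = hatn b n.
Proof.
move=> b1; case: n => [|n] /=; first by rewrite (star0 mM).
by rewrite (star_lt mM) // -bar_tau_rank.
Qed.

Definition M1_hat n (b : 'I_n -> M1) : M := cm_hat_pred (fun i => sval (b i)).

Definition ca_of_cm_q n (a : M1) (b : 'I_n -> M1) : M1 :=
  to_M1 (mul (sval a) (M1_hat b)).

Lemma cm_coord_M1 x n : star 1 (cm_coord x n) one = cm_coord x n.
Proof. exact: star1_M1. Qed.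

Definition ca_of_cm_e (n : nat) : M1 := exist _ (cm_coord one n) (cm_coord_M1 one n).

Lemma M1_coeq_eq (x y : M1) : coeq 0 (sval x) (sval y) -> x = y.
Proof.
move=> xy; apply: M1_ext; apply: (coeq_eq (n := 1)).
- exact: (svalP x).
- exact: (svalP y).
- by case.
Qed.

Lemma coeq_star1 x : coeq 0 (star 1 x one) x.
Proof. exact: coeq_starL. Qed.

Lemma pad_M1 n (b : 'I_n -> M1) i :
  star 1 (pad (fun _ => one) (fun i => sval (b i)) i) one =
  pad (fun _ => one) (fun i => sval (b i)) i.
Proof.
rewrite /pad; case: insubP => [j _ _|_] /=; last exact: (starxx mM).
exact: (svalP (b j)).
Qed.

Lemma M1_hat_rank n (b : 'I_n -> M1) : star n (M1_hat b) one = M1_hat b.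
Proof. by rewrite /M1_hat cm_hat_predE hatn_rank //; exact: pad_M1. Qed.

Lemma coeq_M1_hat n (b : 'I_n -> M1) (i : 'I_n) :
  coeq i (M1_hat b) (bar (stau i) (sval (b i))).
Proof.
rewrite /M1_hat cm_hat_predE.
have := coeq_hatn (pad (fun _ => one) (fun i => sval (b i))) (ltn_ord i).
by rewrite {2}/pad valK.
Qed.

Lemma coeq_M1_hat_ge n (b : 'I_n -> M1) j : n <= j -> coeq j (M1_hat b) one.
Proof. by move=> nj; rewrite -M1_hat_rank; exact: coeq_starR. Qed.

Lemma star_rankW n k x : n <= k -> star n x one = x -> star k x one = x.
Proof.
rewrite leq_eqVlt => /predU1P[->//|nk] <-.
by rewrite (star_lt mM) // (starxx mM).
Qed.

Lemma coeq_bar_tau i x y : coeq 0 x y -> coeq i (bar (stau i) x) (bar (stau i) y).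
Proof. by apply: coeq_bar; exact: stau0. Qed.

Lemma coeq_tau_bar i x y : coeq i x y -> coeq 0 (bar (stau i) x) (bar (stau i) y).
Proof. exact: coeq_bar. Qed.

Lemma coeq_bar_coord i x : coeq i (bar (stau i) (cm_coord x i)) x.
Proof. by have := coeq_bar_tau i (coeq_star1 (bar (stau i) x)); rewrite bar_tauK. Qed.

Lemma coeq_q_e j n (x : 'I_n -> M1) :
  coeq 0 (sval (ca_of_cm_q (ca_of_cm_e j) x)) (bar (stau j) (M1_hat x)).
Proof.
apply: (coeq_trans (coeq_star1 _)).
apply: (coeq_trans (coeq_mul _ (coeq_star1 _))).
by rewrite -cm_barM cm_mul1.
Qed.

Lemma ca_of_cm_qe n (i : 'I_n) (x : 'I_n -> M1) :
  ca_of_cm_q (ca_of_cm_e i) x = x i.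
Proof.
apply: M1_coeq_eq; apply: (coeq_trans (coeq_q_e _ _)).
by have := coeq_tau_bar (coeq_M1_hat x i); rewrite bar_tauK.
Qed.

Lemma ca_of_cm_qe_ge n j (x : 'I_n -> M1) :
  n <= j -> ca_of_cm_q (ca_of_cm_e j) x = ca_of_cm_e j.
Proof.
move=> nj; apply: M1_coeq_eq; apply: (coeq_trans (coeq_q_e _ _)).
apply: (coeq_trans (coeq_tau_bar (coeq_M1_hat_ge x nj))).
exact: (coeq_sym (coeq_star1 _)).
Qed.

Lemma M1_hat_e n : M1_hat (fun i : 'I_n => ca_of_cm_e i) = one.
Proof.
apply: (coeq_eq (n := n)); [exact: M1_hat_rank|exact: (starxx mM)|move=> i i_n].
apply: (coeq_trans (coeq_M1_hat _ (Ordinal i_n))).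
exact: coeq_bar_coord.
Qed.

Lemma ca_of_cm_q_id n x : ca_of_cm_q x (fun i : 'I_n => ca_of_cm_e i) = x.
Proof. by apply: M1_ext; rewrite /= M1_hat_e cm_mulr1 (svalP x). Qed.

Lemma M1_hat_pad n k (y : 'I_n -> M1) : n < k ->
  M1_hat (fun i : 'I_k => pad ca_of_cm_e y i) = M1_hat y.
Proof.
move=> nk; apply: (coeq_eq (n := k)); first exact: M1_hat_rank.
  exact: (star_rankW (ltnW nk) (M1_hat_rank y)).
move=> i ik; apply: (coeq_trans (coeq_M1_hat _ (Ordinal ik))) => /=.
rewrite /pad; case: insubP => [j _ <-|]; first exact/coeq_sym/coeq_M1_hat.
rewrite -leqNgt => ni; apply: (coeq_trans (coeq_bar_coord _ _)).
exact/coeq_sym/coeq_M1_hat_ge.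
Qed.

Lemma ca_of_cm_q_pad n k x (y : 'I_n -> M1) : n < k ->
  ca_of_cm_q x y = ca_of_cm_q x (fun i : 'I_k => pad ca_of_cm_e y i).
Proof. by move=> nk; rewrite /ca_of_cm_q M1_hat_pad. Qed.

Lemma M1_hat_mul n (y z : 'I_n -> M1) :
  mul (M1_hat y) (M1_hat z) = M1_hat (fun i => ca_of_cm_q (y i) z).
Proof.
apply: (coeq_eq (n := n)); last 1 first.
- move=> i i_n; apply: (coeq_trans (coeq_mul _ (coeq_M1_hat _ (Ordinal i_n)))).
  apply: coeq_sym; apply: (coeq_trans (coeq_M1_hat _ (Ordinal i_n))) => /=.
  rewrite -cm_barM; exact/coeq_bar_tau/coeq_star1.
- rewrite -{1}(M1_hat_rank y) cm_starM cm_mul1 (star_geL mM) //.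
  by rewrite -{2}(M1_hat_rank y) cm_starM cm_mul1 -{3}(M1_hat_rank z) (star_geR mM).
- exact: M1_hat_rank.
Qed.

Lemma ca_of_cm_qq n x (y z : 'I_n -> M1) :
  ca_of_cm_q (ca_of_cm_q x y) z = ca_of_cm_q x (fun i => ca_of_cm_q (y i) z).
Proof.
apply: M1_coeq_eq; apply: (coeq_trans (coeq_star1 _)).
apply: (coeq_trans (coeq_mul _ (coeq_star1 _))).
by rewrite -cm_mulA M1_hat_mul; exact/coeq_sym/coeq_star1.
Qed.

Definition ca_of_cm : clone_algebra :=
  @CloneAlgebra M1 ca_of_cm_e ca_of_cm_q ca_of_cm_qe ca_of_cm_qe_ge
    ca_of_cm_q_id ca_of_cm_q_pad ca_of_cm_qq.

End CaOfCm.

Section CaOfCmHom.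
Variables (M N : cm_monoid) (g : cm_hom M N).

Lemma M1_map_proof (x : M1 M) : cm_star 1 (g (sval x)) cm_one = g (sval x).
Proof. by rewrite -(cm_fun_one g) -cm_fun_star (svalP x). Qed.

Definition M1_map (x : M1 M) : M1 N := exist _ (g (sval x)) (M1_map_proof x).

Lemma cm_fun_hat (b : nat -> M) i : g (cm_hat b i) = cm_hat (g \o b) i.
Proof. by elim: i => //= i IH; rewrite cm_fun_star cm_fun_bar IH. Qed.

Lemma M1_map_hat n (b : 'I_n -> M1 M) : g (M1_hat b) = M1_hat (M1_map \o b).
Proof.
rewrite /M1_hat /cm_hat_pred; case: n b => [|n] b; first exact: cm_fun_one.
rewrite cm_fun_hat; congr cm_hat; apply: funext => i.
by rewrite /pad /=; case: insub => //=; rewrite cm_fun_one.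
Qed.

Program Definition ca_of_cm_hom : ca_hom (ca_of_cm M) (ca_of_cm N) :=
  @CaHom (ca_of_cm M) (ca_of_cm N) M1_map _ _.
Next Obligation.
by move=> n; apply: M1_ext; rewrite /= /cm_coord cm_fun_star cm_fun_bar cm_fun_one.
Qed.
Next Obligation.
move=> n x y; apply: M1_ext.
by rewrite /= cm_fun_star cm_fun_mul cm_fun_one M1_map_hat.
Qed.

End CaOfCmHom.

Program Definition ca_functor : functor CM CA :=
  @Functor CM CA ca_of_cm ca_of_cm_hom _ _.
Next Obligation. by move=> M; apply: ca_hom_ext => x; exact: M1_ext. Qed.
Next Obligation.
by move=> M N P g f; apply: ca_hom_ext => x; exact: M1_ext.
Qed.

Definition ca_fr_functor : functor CMfr CA :=
  comp_functor ca_functor (@full_incl CM cm_finitely_ranked).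

(* Main.v *)
Require Import Defs.
From mathcomp Require Import all_boot.
From mathcomp Require Import boolp classical_sets cardinality.

(** An element of a merge algebra behaves like a sequence whose [i]-th entry is
    its class under [coeq i], and in a finitely ranked cm-monoid these entries
    determine it. The unit sends [x] in a clone algebra to the thread
    [(x, e_1, e_2, ...)]; the inverse of the counit sends [x] in a cm-monoid to
    the thread of its coordinates [cm_coord x i]. Finite dimensionality transfers
    because, if [a] is independent of [e_j], then [q(a, s)] ignores the [j]-th
    entry of [s], so that [a] is fixed by the substitutions that only move
    coordinates on which it does not depend. *)

Set Implicit Arguments.
Unset Strict Implicit.
Unset Printing Implicit Defensive.

Local Open Scope classical_set_scope.
#[local] Obligation Tactic := idtac.

(** * Inverses of bijective homomorphisms *)

Program Definition ca_hom_inv (C D : clone_algebra) (f : ca_hom C D) (g : D -> C)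
  (fK : cancel f g) (gK : cancel g f) : ca_hom D C := @CaHom D C g _ _.
Next Obligation. by move=> C D f g fK gK n; rewrite -(ca_fun_e f) fK. Qed.
Next Obligation.
move=> C D f g fK gK n x y; apply: (can_inj fK).
rewrite gK ca_fun_q gK; congr ca_q.
by apply: funext => i; rewrite gK.
Qed.

Program Definition cm_hom_inv (M N : cm_monoid) (f : cm_hom M N) (g : N -> M)
  (fK : cancel f g) (gK : cancel g f) : cm_hom N M := @CmHom N M g _ _ _ _.
Next Obligation.
by move=> M N f g fK gK x y; apply: (can_inj fK); rewrite cm_fun_mul !gK.
Qed.
Next Obligation. by move=> M N f g fK gK; rewrite -(cm_fun_one f) fK. Qed.
Next Obligation.
by move=> M N f g fK gK n x y; apply: (can_inj fK); rewrite cm_fun_star !gK.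
Qed.
Next Obligation.
by move=> M N f g fK gK s x; apply: (can_inj fK); rewrite cm_fun_bar !gK.
Qed.

(** * The unit on a clone algebra *)

Section Unit.
Variable C : clone_algebra.

(** Turns the general facts on coordinates of [M1_hat] into equations between entries of threads; it
    comes from evaluating [coeq] at index [i]. *)
Lemma coeq_thread i (s t : cm_of_ca C) : coeq i s t -> tseq s i = tseq t i.
Proof.
move=> /(_ cm_one cm_one) /(congr1 (fun u : thread C => u i)) /=.
by rewrite ltnSn ltnn.
Qed.

Lemma thread_head_fin (x : C) :
  finite_set [set i | (if i == 0 then x else ca_e i) <> ca_e i].
Proof. by apply: cofinite_thread; exists 1 => -[]. Qed.

Definition thread_head (x : C) : cm_of_ca C := Thread (thread_head_fin x).

Lemma thread_head_M1 x : cm_star 1 (thread_head x) cm_one = thread_head x.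
Proof. by apply: thread_ext => -[]. Qed.

Definition ca_unit_fun (x : C) : ca_of_cm (cm_of_ca C) :=
  exist _ (thread_head x) (thread_head_M1 x).

Definition ca_unit_inv_fun (x : ca_of_cm (cm_of_ca C)) : C := tseq (sval x) 0.

Lemma ca_unit_funK : cancel ca_unit_fun ca_unit_inv_fun.
Proof. by []. Qed.

Lemma ca_unit_inv_funK : cancel ca_unit_inv_fun ca_unit_fun.
Proof.
by move=> [x x1]; apply: M1_ext; rewrite -[RHS]x1; apply: thread_ext => -[].
Qed.

Program Definition ca_unit : ca_hom C (ca_of_cm (cm_of_ca C)) :=
  @CaHom _ (ca_of_cm (cm_of_ca C)) ca_unit_fun _ _.
Next Obligation. by move=> n; apply: M1_ext; apply: thread_ext => -[]. Qed.
Next Obligation.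
move=> n x y; apply: (can_inj ca_unit_inv_funK).
rewrite /ca_unit_inv_fun /=.
(* From index [n] on, the hat has the entries of the unit thread, so [n] is a valid bound for the
   substitution. *)
rewrite (@tsubstE _ _ _ n) => [|i /(coeq_M1_hat_ge (ca_unit_fun \o y))/coeq_thread //].
congr ca_q; apply: funext => i.
have /coeq_thread -> := coeq_M1_hat (ca_unit_fun \o y) i.
by rewrite /= (_ : tau_fun i i = 0) //; exact: stau0.
Qed.

Definition ca_unit_inv : ca_hom (ca_of_cm (cm_of_ca C)) C :=
  ca_hom_inv (f := ca_unit) ca_unit_funK ca_unit_inv_funK.

End Unit.

(** * The counit on a finitely ranked cm-monoid *)

Section Counit.
Variables (M : cm_monoid) (Mfr : cm_finitely_ranked M).
Let mM := cm_merge M.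

Lemma to_M1_eq (x y : M) : coeq 0 x y -> to_M1 x = to_M1 y.
Proof. by move=> xy; apply/M1_ext/coeq_starP => -[]. Qed.

Lemma coords_fin (x : M) :
  finite_set [set i | to_M1 (cm_bar (stau i) x) <> @ca_e (ca_of_cm M) i].
Proof.
have [n xn] := Mfr x; apply: (@cofinite_thread (ca_of_cm M)); exists n => i ni.
apply: M1_ext; apply: coeq_starP => -[] // _; apply: coeq_tau_bar.
by rewrite -xn; exact: coeq_starR.
Qed.

Definition coords (x : M) : cm_of_ca (ca_of_cm M) := 
  @Thread (ca_of_cm M) (fun i => to_M1 (cm_bar (stau i) x)) (coords_fin x).

Definition thread_hat (s : cm_of_ca (ca_of_cm M)) : M :=
  M1_hat (fun i : 'I_(trank s) => tseq s i).

(** Past [trank s] both sides have the coordinate of the unit, so the arbitrary cutoff in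
    [thread_hat] does not show in the coordinates. *)
Lemma coeq_thread_hat (s : cm_of_ca (ca_of_cm M)) i :
  coeq i (thread_hat s) (cm_bar (stau i) (sval (tseq s i))).
Proof.
have [ir|ri] := ltnP i (trank s); first exact: (coeq_M1_hat _ (Ordinal ir)).
apply: (coeq_trans (coeq_M1_hat_ge _ ri)); rewrite trankP //.
exact/coeq_sym/coeq_bar_coord.
Qed.

Lemma coordsK : cancel coords thread_hat.
Proof.
(* [coeq_eq] asks for one rank common to both elements. *)
move=> x; have [n xn] := Mfr x; pose r := maxn n (trank (coords x)).
apply: (coeq_eq (n := r)).
- by apply: (star_rankW (leq_maxr _ _)); exact: M1_hat_rank.
- exact: (star_rankW (leq_maxl _ _)).
move=> i _; apply: (coeq_trans (coeq_thread_hat _ _)).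
exact: coeq_bar_coord.
Qed.

Lemma thread_hatK : cancel thread_hat coords.
Proof.
move=> s; apply: thread_ext => i; apply: M1_coeq_eq.
apply: (coeq_trans (coeq_star1 _)).
by have := coeq_tau_bar (coeq_thread_hat s i); rewrite bar_tauK.
Qed.

Program Definition coords_hom : cm_hom M (cm_of_ca (ca_of_cm M)) :=
  @CmHom _ (cm_of_ca (ca_of_cm M)) coords _ _ _ _.
Next Obligation.
move=> x y; apply: thread_ext => i; rewrite /= /tsubst.
(* The product in the thread monoid substitutes the hat of [coords y], which is [y] itself. *)
have hy := coordsK y; rewrite /thread_hat in hy.
apply: to_M1_eq; rewrite hy cm_barM /=.
exact/coeq_mul/coeq_sym/coeq_star1.
Qed.
Next Obligation. by apply: thread_ext => i; exact: M1_ext. Qed.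
Next Obligation.
move=> n x y; apply: thread_ext => i /=.
case: ltnP => ni; apply/to_M1_eq/coeq_tau_bar.
  exact: coeq_starL.
exact: coeq_starR.
Qed.
Next Obligation.
move=> s x; apply: thread_ext => i /=; apply: to_M1_eq.
(* Both permutations send 0 to [s i], and coordinate 0 depends on nothing else. *)
by rewrite (bar_comp mM); exact: coeq_local.
Qed.

Definition thread_hat_hom : cm_hom (cm_of_ca (ca_of_cm M)) M :=
  cm_hom_inv (f := coords_hom) coordsK thread_hatK.

End Counit.

(** * Naturality of the unit and the counit *)

Lemma coords_natural (M N : cm_monoid) (Mfr : cm_finitely_ranked M)
    (Nfr : cm_finitely_ranked N) (f : cm_hom M N) x :
  thread_map (ca_of_cm_hom f) (coords Mfr x) = coords Nfr (f x).
Proof.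
apply: thread_ext => i; apply: M1_ext.
by rewrite /= cm_fun_star cm_fun_bar cm_fun_one.
Qed.

Program Definition unit_iso :
    nat_iso (id_functor CA) (comp_functor ca_fr_functor cm_fr_functor) :=
  @NatIso _ _ (id_functor CA) (comp_functor ca_fr_functor cm_fr_functor)
    ca_unit ca_unit_inv _ _ _.
Next Obligation. by move=> C; apply: ca_hom_ext. Qed.
Next Obligation. by move=> C; apply: ca_hom_ext => x; exact: ca_unit_inv_funK. Qed.
Next Obligation.
move=> C D f; apply: ca_hom_ext => x; apply: M1_ext; apply: thread_ext => i /=.
by case: eqP => // _; exact: ca_fun_e.
Qed.

Program Definition counit_iso :
    nat_iso (comp_functor cm_fr_functor ca_fr_functor) (id_functor CMfr) :=
  @NatIso _ _ (comp_functor cm_fr_functor ca_fr_functor) (id_functor CMfr)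
    (fun M => thread_hat_hom (svalP M)) (fun M => coords_hom (svalP M)) _ _ _.
Next Obligation. by move=> M; apply: cm_hom_ext => s; exact: thread_hatK. Qed.
Next Obligation. by move=> M; apply: cm_hom_ext => x; exact: coordsK. Qed.
Next Obligation.
move=> M N f; apply: cm_hom_ext => s /=.
(* Writing [s] as the coordinates of its hat reduces naturality of the counit to that of its
   inverse. *)
rewrite -{2}(thread_hatK (svalP M) s) (coords_natural (svalP M) (svalP N)).
by rewrite coordsK.
Qed.

(** * Transfer of finite dimensionality *)

(** Let [u] be the unit thread with [e_j] replaced by [e_(j+1)]. Independence gives [a = q(a, u)],
    and the products of [u] with [s] and with [t] never read their entry [j]. *)
Lemma tsubst_independent (C : clone_algebra) (a : C) j (s t : thread C) :
  ca_independent a j -> (forall i, i != j -> s i = t i) -> tsubst a s = tsubst a t.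
Proof.
move=> aj st.
have fin : finite_set
    [set i | (if i == j then ca_e j.+1 else ca_e i) <> @ca_e C i].
  apply: cofinite_thread; exists j.+1 => i ji.
  by rewrite eqn_leq leqNgt ji.
pose u := Thread fin.
have -> : a = tsubst a u.
  rewrite (@tsubstE _ _ _ j.+1) => [|i ji /=]; last by rewrite eqn_leq leqNgt ji.
  rewrite -[LHS]aj; congr ca_q; apply: funext => -[i /=].
  by rewrite ltnS leq_eqVlt; case: eqVneq => [->|_ /= ->] //; rewrite ltnn.
rewrite -!tsubstA; congr tsubst; apply: thread_ext => i /=.
case: eqVneq => [_|ij]; rewrite !tsubst_e st //.
by rewrite eqn_leq ltnn.
Qed.

Lemma ca_fd_bound (C : clone_algebra) (a : C) : ca_fd_elt a ->
  exists m, forall j, m <= j -> ca_independent a j.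
Proof.
move=> /nat_finite_bound[m am]; exists m => j mj; apply: contrapT => /am.
by rewrite ltnNge mj.
Qed.

Lemma cm_functor_fd (C : CA) : ca_finite_dim C ->
  cm_finite_dim (cm_functor C) /\ cm_finitely_ranked (cm_functor C).
Proof.
move=> Cfd; split; last exact: cm_of_ca_finitely_ranked.
move=> a n.
(* Only the first [n] entries of [a] matter, so a maximum of finitely many bounds serves them
   all. *)
have [m am] : exists m, forall i j, i < n -> m <= j -> ca_independent (tseq a i) j.
  elim: n => [|n [m am]]; first by exists 0.
  have [p ap] := ca_fd_bound (Cfd (tseq a n)).
  exists (maxn m p) => i j; rewrite ltnS geq_max leq_eqVlt.
  by case/predU1P => [->|i_n] /andP[mj pj]; [exact: ap|exact: am].
exists m => b k; apply: thread_ext => i /=; case: ltnP => // i_n.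
(* For [k = 0] the substituted thread is the unit; going from [k] to [k + 1] changes only entry
   [m + k], of which the entry of [a] is independent. *)
elim: k => [|k IH].
  rewrite -[RHS]tsubst1; congr tsubst; apply: thread_ext => j /=.
  by rewrite addn0; case: ltnP.
rewrite -[RHS]IH; apply: (tsubst_independent (j := m + k)).
  by apply: am => //; exact: leq_addr.
by move=> j jmk /=; rewrite addnS ltnS leq_eqVlt (negPf jmk).
Qed.

Lemma ca_functor_fd (M : CM) :
  cm_finite_dim M /\ cm_finitely_ranked M -> ca_finite_dim (ca_functor M).
Proof.
move=> [Mfd _] a; have mM := cm_merge M.
(* Level 1 suffices, since [a] is determined by its coordinate 0. *)
have [m am] := Mfd (sval a) 1.
apply/nat_finite_bound; exists m => j nindep; rewrite ltnNge; apply/negP => mj.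
apply: nindep; rewrite /ca_independent; set b := fun i : 'I_j.+1 => _.
apply: M1_ext; change (cm_star 1 (cm_mul (sval a) (M1_hat b)) cm_one = sval a).
(* The hat of [b] differs from the unit at most at coordinate [j]. As [m <= j], it has the shape
   required by [am], with [k = j + 1 - m]. *)
have bE : cm_star j.+1 (cm_star m cm_one (M1_hat b)) cm_one = M1_hat b.
  apply: (coeq_eq (n := j.+1)); first by rewrite (star_geL mM).
    exact: M1_hat_rank.
  move=> i ij; apply: (coeq_trans (coeq_starL _ _ ij)).
  have [im|mi] := ltnP i m; last exact: coeq_starR.
  apply: (coeq_trans (coeq_starL _ _ im)); apply: coeq_sym.
  apply: (coeq_trans (coeq_M1_hat _ (Ordinal ij))).
  by rewrite /b /= (leq_trans im mj); exact: coeq_bar_coord.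
have := am (M1_hat b) (j.+1 - m); rewrite subnKC ?(leq_trans mj) // bE => ab.
by rewrite -{2}(svalP a) -{2}ab (star_geL mM).
Qed.

(** * The equivalence and its restriction *)

Definition equivalence_fr : equivalence cm_fr_functor ca_fr_functor :=
  Equivalence unit_iso counit_iso.

Definition cm_fd_functor : functor CAfd CMfdr :=
  birestrict (F := cm_functor) cm_functor_fd.

Definition ca_fd_functor : functor CMfdr CAfd :=
  birestrict (F := ca_functor) ca_functor_fd.

Program Definition unit_iso_fd :
    nat_iso (id_functor CAfd) (comp_functor ca_fd_functor cm_fd_functor) :=
  @NatIso CAfd CAfd (id_functor CAfd) (comp_functor ca_fd_functor cm_fd_functor)
    (fun C => unit_iso (sval C)) (fun C => niso_inv unit_iso (sval C)) _ _ _.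
Next Obligation. by move=> C; exact: (nisoK unit_iso (sval C)). Qed.
Next Obligation. by move=> C; exact: (niso_invK unit_iso (sval C)). Qed.
Next Obligation. by move=> C D f; exact: (niso_nat unit_iso f). Qed.

Definition fdr_fr (M : CMfdr) : CMfr := exist _ (sval M) (proj2 (svalP M)).

Program Definition counit_iso_fd :
    nat_iso (comp_functor cm_fd_functor ca_fd_functor) (id_functor CMfdr) :=
  @NatIso CMfdr CMfdr (comp_functor cm_fd_functor ca_fd_functor) (id_functor CMfdr)
    (fun M => counit_iso (fdr_fr M)) (fun M => niso_inv counit_iso (fdr_fr M))
    _ _ _.
Next Obligation. by move=> M; exact: (nisoK counit_iso (fdr_fr M)). Qed.
Next Obligation. by move=> M; exact: (niso_invK counit_iso (fdr_fr M)). Qed.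
Next Obligation.
by move=> M N f; exact: (niso_nat counit_iso (a := fdr_fr M) (b := fdr_fr N) f).
Qed.

Theorem theorem6p12 :
  exists E : equivalence cm_fr_functor ca_fr_functor,
  exists (cm_fd : forall C : CA, ca_finite_dim C ->
            cm_finite_dim (cm_functor C) /\ cm_finitely_ranked (cm_functor C))
         (ca_fd : forall M : CM, cm_finite_dim M /\ cm_finitely_ranked M ->
            ca_finite_dim (ca_functor M)),
  exists E' : equivalence (birestrict cm_fd : functor CAfd CMfdr)
                          (birestrict ca_fd : functor CMfdr CAfd),
    (forall C : CAfd, eq_unit E' C = eq_unit E (sval C)) /\
    (forall M : CMfdr,
       eq_counit E' M = eq_counit E (exist _ (sval M) (proj2 (svalP M)))).
Proof.
exists equivalence_fr, cm_functor_fd, ca_functor_fd.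
(* The restricted unit and counit reuse the unrestricted components, so both compatibilities hold by
   computation. *)
by exists (Equivalence unit_iso_fd counit_iso_fd).
Qed.
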